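(* Let $r>0$, let $n\in\{1,2\}$ and let $\Omega=\{A_i : 1\le i\le n\}$ be a set of coin-flipping games (positive profits, all determined by the same coin toss) which is a basis of the convex cone $\widehat\Omega$ it generates. Then the system of least-squares prices in $\Omega$ is arbitrage-free, and there is a mixed game which earns the growth rate $e^r$ exactly. That is: for every nonzero mixed game $M=\sum_{i=1}^n k_iA_i\in\widehat\Omega$ (with $k_i\ge 0$), offered at its least-squares price $u_r^{M,\Omega}=\sum_{i=1}^n k_i u_r^{A_i,\Omega}$, the limit expectation of the growth rate satisfies $$G^{M}_{u_r^{M,\Omega}}\le e^{r},$$ and there exists a nonzero mixed game $M\in\widehat\Omega$ for which $G^{M}_{u_r^{M,\Omega}}=e^{r}$.
   Context: Games. A coin-flipping game $A=(a,b)$, $a,b>0$, pays profit $a$ if a tossed fair coin yields heads and $b$ if it yields tails. All games considered depend on the same coin toss (they are completely correlated), so games are added and multiplied by nonnegative scalars as vectors in $\mathbb{R}^2$. Put $E^A:=(a+b)/2$. Growth rate and price. Suppose game $A=(a,b)$ is offered at price $u>0$, and let $t\in[0,1]$. The investor starts with capital $1$ and repeatedly invests the fraction $t$ of the current capital in independent plays: current capital $c$ becomes $act/u+c(1-t)$ with probability $1/2$ (heads) and $bct/u+c(1-t)$ with probability $1/2$ (tails). Let $c_N$ be the capital after $N$ plays. $G_u^A$ (the limit expectation of the growth rate) denotes the maximum over $t\in[0,1]$ of $\lim_{N\to\infty}\mathbb{E}[c_N^{1/N}]$. For the risk-free continuously compounded interest rate $r>0$, the price $u_r^A$ is the value $u>0$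 determined by $G_u^A=e^r$. (One has $0<u_r^A\le E^A/e^r$ and $u_r^{kA}=k u_r^A$ for $k>0$.) Cone and basis. $\widehat\Omega:=\{\sum_{i=1}^n k_iA_i : k_i\ge 0\}$; its elements are called mixed games. $\Omega=\{A_i:1\le i\le n\}$ being a basis means that $\sum_i k_iA_i=\sum_i k_i'A_i$ with $k_i,k_i'\ge0$ implies $k_i=k_i'$ for all $i$. Least-squares prices. Let $S:=\{(t_i)\in\mathbb{R}^n : 0\le t_i\le 1\}$ and $Q:=\{(p_i)\in\mathbb{R}^n : \sum_i p_i=1,\ p_i\ge 0\}$. For $(t_i)\in S$ define $$L((t_i)):=\sup_{(p_i)\in Q}\frac{u_r^{\sum_{i=1}^n p_iA_i}}{\sum_{i=1}^n p_i\bigl(u_r^{A_i}+t_i(E^{A_i}/e^r-u_r^{A_i})\bigr)}.$$ The set $T:=\{(t_i)\in S: L((t_i))\le 1\}$ is nonempty, convex and compact, so there is a unique point $(x_i)\in T$ minimizing $\sum_i t_i^2$ over $T$. The least-squares price of $A_i$ in $\Omega$ is $u_r^{A_i,\Omega}:=u_r^{A_i}+x_i(E^{A_i}/e^r-u_r^{A_i})$, and for a mixed game $\sum_i k_iA_i\in\widehat\Omega$ one defines $u_r^{\sum_i k_iA_i,\,\Omega}:=\sum_i k_i u_r^{A_i,\Omega}$. Arbitrage-free. A system of prices is arbitrage-free if no investor has an opportunity to earn a profit exceeding the risk-free interest rate, i.e. no nonzero mixed game, at its price, has limit expectation of the growth rate exceeding $e^r$. *)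

(* Defs.v *)
From HB Require Import structures.
From mathcomp Require Import all_boot all_order all_algebra.
From mathcomp Require Import all_classical all_reals all_analysis.

Set Implicit Arguments.
Unset Strict Implicit.
Unset Printing Implicit Defensive.

Import Order.TTheory GRing.Theory Num.Theory.
Import numFieldNormedType.Exports.

Local Open Scope classical_set_scope.
Local Open Scope ring_scope.

(* A game (a, b) is the row vector with entries a (heads) and b (tails).
   Vectors with zero entries are allowed here, so that mixed games with zero
   weights make sense; positivity of the profits is [positive_game]. *)
Definition profit (R : realType) (A : 'rV[R]_2) (heads : bool) : R :=
  A 0 (if heads then ord0 else ord_max).

Definition positive_game (R : realType) (A : 'rV[R]_2) : Prop :=
  forall heads : bool, 0 < profit A heads.

Definition mean_profit (R : realType) (A : 'rV[R]_2) : R :=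
  (profit A true + profit A false) / 2.

(* Capital after the tosses [w], starting from 1 and investing the fraction
   [t] of the current capital in the game [A] at price [u] in each play. *)
Definition capital (R : realType) (A : 'rV[R]_2) (u t : R) (w : seq bool) : R :=
  foldl (fun c heads => profit A heads * c * t / u + c * (1 - t)) 1 w.

(* E[c_N^(1/N)]: the average over the 2^N equally likely sequences of N
   independent tosses of a fair coin. *)
Definition expected_root (R : realType) (A : 'rV[R]_2) (u t : R) (N : nat) : R :=
  (\sum_(w : N.-tuple bool) capital A u t w `^ (N%:R^-1)) / 2 ^+ N.

Definition limit_rate (R : realType) (A : 'rV[R]_2) (u t : R) : R :=
  limn (expected_root A u t).

(* G_u^A: the greatest element of the set of limit rates, t in [0, 1].  Here
   and below, [xget] picks an element of a set, its first argument being an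
   irrelevant value returned when the set is empty. *)
Definition growth_rate (R : realType) (A : 'rV[R]_2) (u : R) : R :=
  let rates := [set limit_rate A u t | t in `[0, 1]] in
  xget 0 (rates `&` ubound rates).

Definition price (R : realType) (r : R) (A : 'rV[R]_2) : R :=
  xget 0 [set u | 0 < u /\ growth_rate A u = expR r].

Definition nonneg (R : realType) (n : nat) (k : 'rV[R]_n) : Prop :=
  forall i, 0 <= k 0 i.

Definition mix (R : realType) (n : nat) (A : 'I_n -> 'rV[R]_2)
    (k : 'rV[R]_n) : 'rV[R]_2 :=
  \sum_i k 0 i *: A i.

Definition cone_basis (R : realType) (n : nat) (A : 'I_n -> 'rV[R]_2) : Prop :=
  forall k k' : 'rV[R]_n, nonneg k -> nonneg k' -> mix A k = mix A k' -> k = k'.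

Definition cube (R : realType) (n : nat) : set 'rV[R]_n :=
  [set t : 'rV[R]_n | forall i, 0 <= t 0 i <= 1].

Definition simplex (R : realType) (n : nat) : set 'rV[R]_n :=
  [set p : 'rV[R]_n | \sum_i p 0 i = 1 /\ nonneg p].

Definition shifted_price (R : realType) (r : R) (n : nat)
    (A : 'I_n -> 'rV[R]_2) (t : 'rV[R]_n) (i : 'I_n) : R :=
  price r (A i) + t 0 i * (mean_profit (A i) / expR r - price r (A i)).

(* The supremum is taken in the extended reals, where it always exists. *)
Definition price_ratio_sup (R : realType) (r : R) (n : nat)
    (A : 'I_n -> 'rV[R]_2) (t : 'rV[R]_n) : \bar R :=
  ereal_sup
    [set (price r (mix A p) / \sum_i p 0 i * shifted_price r A t i)%:E
       | p in @simplex R n].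

Definition admissible (R : realType) (r : R) (n : nat)
    (A : 'I_n -> 'rV[R]_2) : set 'rV[R]_n :=
  [set t : 'rV[R]_n | cube t /\ (price_ratio_sup r A t <= 1%:E)%E].

Definition least_squares_point (R : realType) (r : R) (n : nat)
    (A : 'I_n -> 'rV[R]_2) : 'rV[R]_n :=
  xget 0 [set x : 'rV[R]_n | admissible r A x /\
    forall t, admissible r A t -> \sum_i x 0 i ^+ 2 <= \sum_i t 0 i ^+ 2].

Definition least_squares_price (R : realType) (r : R) (n : nat)
    (A : 'I_n -> 'rV[R]_2) (i : 'I_n) : R :=
  shifted_price r A (least_squares_point r A) i.

Definition mixed_price (R : realType) (n : nat) (v : 'I_n -> R)
    (k : 'rV[R]_n) : R :=
  \sum_i k 0 i * v i.

Definition arbitrage_free (R : realType) (r : R) (n : nat)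
    (A : 'I_n -> 'rV[R]_2) (v : 'I_n -> R) : Prop :=
  forall k : 'rV[R]_n, nonneg k -> mix A k != 0 ->
    growth_rate (mix A k) (mixed_price v k) <= expR r.

(* Main.v *)
(* Writing x and y for the factors by which heads and tails multiply the
   capital, E[c_N^(1/N)] = ((x^(1/N) + y^(1/N)) / 2)^N, which tends to
   sqrt (x y).  Hence the limit rate decreases with the price, the price of a
   game is unique, and it has a closed form that is continuous in the game.
   By definition of T, every mixed game is worth at most its least-squares
   price, so no mixed game grows faster than e^r.  By compactness the supremum
   rho of the ratio (price) / (least-squares price) is attained on the simplex.
   If rho = 1, the maximizer earns exactly e^r.  If rho < 1, then rho x still
   lies in T, because u_i + rho x_i d_i >= rho (u_i + x_i d_i) for the prices
   u_i and d_i = E_i/e^r - u_i; minimality of the norm of x forces x = 0, and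
   then each single game earns exactly e^r. *)
Require Import Defs.
From HB Require Import structures.
From mathcomp Require Import all_boot all_order all_algebra ring lra.
From mathcomp Require Import all_classical all_reals all_analysis.

Set Implicit Arguments.
Unset Strict Implicit.
Unset Printing Implicit Defensive.

Import Order.TTheory GRing.Theory Num.Theory.
Import numFieldNormedType.Exports.
Local Open Scope classical_set_scope.
Local Open Scope ring_scope.

(** * The limit of the expected N-th root of the capital *)

Definition play_factor (R : realType) (A : 'rV[R]_2) (u t : R) (heads : bool) : R :=
  profit A heads * t / u + (1 - t).

Lemma foldl_scale (R : realType) (f : bool -> R) (w : seq bool) (c : R) :
  foldl (fun c heads => f heads * c) c w = c * \prod_(h <- w) f h.
Proof.
elim: w c => [|h w IH] c /=; first by rewrite big_nil mulr1.
by rewrite IH big_cons; ring.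
Qed.

Lemma capitalE (R : realType) (A : 'rV[R]_2) (u t : R) (w : seq bool) :
  capital A u t w = \prod_(h <- w) play_factor A u t h.
Proof.
rewrite -[RHS]mul1r -foldl_scale /capital.
congr foldl; apply/funext => c; apply/funext => h; rewrite /play_factor; ring.
Qed.

Lemma sum_prod_tuple (R : comPzSemiRingType) (I : finType) (f : I -> R) (N : nat) :
  \sum_(w : N.-tuple I) \prod_(i <- w) f i = (\sum_i f i) ^+ N.
Proof.
rewrite -[N in RHS]card_ord -prodr_const bigA_distr_bigA.
rewrite (reindex (@tuple_of_finfun I N)) /=; last first.
  by exists (@finfun_of_tuple I N) => ? _;
    rewrite ?tuple_of_finfunK ?finfun_of_tupleK.
by apply: eq_bigr => g _; rewrite big_map big_enum.
Qed.

Lemma powR_prod (R : realType) (I : Type) (s : seq I) (f : I -> R) (e : R) :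
  (forall i, 0 <= f i) ->
  (\prod_(i <- s) f i) `^ e = \prod_(i <- s) f i `^ e.
Proof.
move=> f0; elim: s => [|i s IH]; first by rewrite !big_nil powR1.
by rewrite !big_cons powRM ?prodr_ge0 // IH.
Qed.

(** The N-th root distributes over the nonnegative factors of the capital. Since the tosses are
    independent, the sum over all toss sequences then factors into the N-th power of a sum over one
    toss. *)
Lemma expected_rootE (R : realType) (A : 'rV[R]_2) (u t : R) (N : nat) :
  (forall h, 0 <= play_factor A u t h) ->
  expected_root A u t N =
    ((play_factor A u t true `^ N%:R^-1 + play_factor A u t false `^ N%:R^-1) / 2) ^+ N.
Proof.
move=> f0; rewrite expr_div_n /expected_root; congr (_ / _).
under eq_bigr do rewrite capitalE powR_prod //.
by rewrite sum_prod_tuple big_bool.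
Qed.

Lemma bernoulli_ineq (R : realDomainType) (x : R) (n : nat) :
  0 <= x <= 1 -> 1 - n%:R * x <= (1 - x) ^+ n.
Proof.
move=> /andP[x0 x1]; elim: n => [|n IH]; first by rewrite mul0r subr0.
have n0 : 0 <= n%:R :> R := ler0n _ n.
by rewrite exprS -natr1; nra.
Qed.

(* Both bounds come from 1 + z <= e^z, applied to z and -z. *)
Lemma cosh_bounds (R : realType) (z : R) : `|z| < 1 ->
  1 <= (expR z + expR (- z)) / 2 <= (1 - z ^+ 2)^-1.
Proof.
rewrite ltr_norml => /andP[z1 z2]; apply/andP; split.
  by have := expR_ge1Dx z; have := expR_ge1Dx (- z); lra.
have h1 : expR z <= (1 - z)^-1.
  rewrite -[leLHS]invrK lef_pV2 ?posrE ?invr_gt0 ?expR_gt0 //; last by lra.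
  by rewrite -expRN; exact: expR_ge1Dx.
have h2 : expR (- z) <= (1 + z)^-1.
  rewrite expRN lef_pV2 ?posrE ?expR_gt0 //; last by lra.
  exact: expR_ge1Dx.
have -> : (1 - z ^+ 2)^-1 = ((1 - z)^-1 + (1 + z)^-1) / 2.
  field. apply/and3P; split; rewrite gt_eqF //; nra.
lra.
Qed.

(** This is cosh (d/n) ^ n. By [cosh_bounds] with z = d/n it lies between 1 and (1 - z^2)^(-n), and
    Bernoulli bounds the latter by (1 - d^2/n)^-1, which tends to 1. *)
Lemma cvg_cosh_root (R : realType) (d : R) :
  ((expR (d / n%:R) + expR (- (d / n%:R))) / 2) ^+ n @[n --> \oo] --> (1 : R).
Proof.
have d2n : (1 - d ^+ 2 / n%:R)^-1 @[n --> \oo] --> (1 : R).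
  have h : n%:R^-1 @[n --> \oo] --> (0 : R).
    by rewrite -cvg_shiftS; exact: cvg_harmonic.
  suff : (1 - d ^+ 2 / n%:R)^-1 @[n --> \oo] --> (1 - d ^+ 2 * 0)^-1.
    by rewrite mulr0 subr0 invr1.
  apply: cvgV; first by rewrite mulr0 subr0 oner_eq0.
  exact: cvgB (cvg_cst _) (cvgM (cvg_cst _) h).
apply: (@squeeze_cvgr _ _ _ _ (fun=> 1) (fun n => (1 - d ^+ 2 / n%:R)^-1)) => //.
  near=> n.
  have n0 : 0 < n%:R :> R by near: n; exact: nbhs_infty_gtr.
  (* This bound gives |d/n| < 1, as [cosh_bounds] requires; the next one keeps 1 - d^2/n
     positive. *)
  have nd : `|d| < n%:R by near: n; exact: nbhs_infty_gtr.
  have nd2 : d ^+ 2 < n%:R by near: n; exact: nbhs_infty_gtr.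
  have z1 : `|d / n%:R| < 1 by rewrite normrM normfV (gtr0_norm n0) ltr_pdivrMr ?mul1r.
  have /andP[c1 c2] := @cosh_bounds R _ z1.
  rewrite exprn_ege1 //=.
  set c := (_ / 2) in c1 c2 *.
  have dn : n%:R * (d / n%:R) ^+ 2 = d ^+ 2 / n%:R by field; rewrite gt_eqF.
  have dn1 : d ^+ 2 / n%:R < 1 by rewrite ltr_pdivrMr ?mul1r.
  have z2 : 0 <= (d / n%:R) ^+ 2 <= 1.
    by rewrite sqr_ge0 -real_normK ?num_real // expr_le1 // ltW.
  apply: (@le_trans _ _ ((1 - (d / n%:R) ^+ 2)^-1 ^+ n)).
    by rewrite lerXn2r // nnegrE; lra.
  rewrite exprVn -dn lef_pV2 ?posrE ?bernoulli_ineq //; first last.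
    by rewrite dn subr_gt0.
  rewrite exprn_gt0 // subr_gt0 -real_normK ?num_real // expr_lt1 //.
exact: cvg_cst.
Unshelve. all: by end_near.
Qed.

(** With m the mean and d half the difference of ln x and ln y, the N-th term is e^m cosh (d/N) ^ N,
    and e^m = sqrt (x y). *)
Lemma limit_rateE (R : realType) (A : 'rV[R]_2) (u t : R) :
  (forall h, 0 < play_factor A u t h) ->
  limit_rate A u t = Num.sqrt (play_factor A u t true * play_factor A u t false).
Proof.
move=> f0.
set x := play_factor A u t true; set y := play_factor A u t false.
have x0 : 0 < x := f0 true.
have y0 : 0 < y := f0 false.
pose m := (ln x + ln y) / 2; pose d := (ln x - ln y) / 2.
have -> : Num.sqrt (x * y) = expR m.
  rewrite -[x in LHS]lnK ?posrE // -[y in LHS]lnK ?posrE // -expRD.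
  have -> : ln x + ln y = m * 2%:R by rewrite /m; field.
  by rewrite expRM_natr sqrtr_sqr ger0_norm ?expR_ge0.
apply: (@cvg_lim R _ _ _ _ _ _ _); first exact: Rhausdorff.
rewrite -[expR m]mulr1.
apply: cvg_trans (cvgM (cvg_cst (expR m)) (cvg_cosh_root d)).
apply: near_eq_cvg; rewrite /=; near=> N.
have N0 : 0 < N%:R :> R by near: N; exact: nbhs_infty_gtr.
rewrite expected_rootE; last by move=> h; exact/ltW.
rewrite -/x -/y /powR !gt_eqF // /=.
have -> : expR m = expR (m / N%:R) ^+ N.
  by rewrite -expRM_natr divfK // gt_eqF.
rewrite -exprMn; congr (_ ^+ _).
rewrite mulrA mulrDr -!expRD /m /d; congr ((expR _ + expR _) / 2); field;
  by rewrite gt_eqF.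
Unshelve. all: by end_near. Qed.

(** * Growth rates: scaling, attainment and monotonicity in the price *)

Lemma limit_rate_scale (R : realType) (A : 'rV[R]_2) (u c : R) : c != 0 ->
  limit_rate (c *: A) (c * u) = limit_rate A u.
Proof.
move=> c0; apply/funext => t; congr (limn _); apply/funext => N.
congr (_ / _); apply: eq_bigr => w _; rewrite !capitalE; congr (_ `^ _).
apply: eq_bigr => h _; rewrite /play_factor /profit mxE; congr (_ + _).
(* At price 0 both quotients are 0, because the inverse of 0 is 0. *)
have [->|u0] := eqVneq u 0; first by rewrite mulr0 invr0 !mulr0.
by field; rewrite c0 u0.
Qed.

(** The condition [0 <= m] covers the default value 0 that [xget] returns when the rates have no
    greatest element. *)
Lemma growth_rate_le (R : realType) (A : 'rV[R]_2) (u m : R) :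
  0 <= m -> (forall t, 0 <= t <= 1 -> limit_rate A u t <= m) ->
  growth_rate A u <= m.
Proof.
move=> m0 le_m; rewrite /growth_rate; case: xgetP => [y _ [[t + <-] _]|//].
by rewrite /= in_itv => /le_m.
Qed.

Lemma growth_rate_eq (R : realType) (A : 'rV[R]_2) (u t : R) :
  0 <= t <= 1 -> (forall s, 0 <= s <= 1 -> limit_rate A u s <= limit_rate A u t) ->
  growth_rate A u = limit_rate A u t.
Proof.
move=> t01 le_t; apply: xget_unique.
  split; first by exists t; rewrite //= in_itv.
  by move=> _ [s + <-]; rewrite /= in_itv => /le_t.
move=> _ [[s + <-] ub_s]; rewrite /= in_itv /= => s01.
have tI : limit_rate A u t <= limit_rate A u s.
  by apply: ub_s; exists t; [rewrite /= in_itv|].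
exact/le_anti/andP/(conj (le_t s s01) tI).
Qed.

(** A nonzero value cannot be the default of [xget], so it is a genuine maximum. *)
Lemma growth_rate_attained (R : realType) (A : 'rV[R]_2) (u : R) :
  growth_rate A u != 0 ->
  exists t, [/\ 0 <= t <= 1, growth_rate A u = limit_rate A u t &
    forall s, 0 <= s <= 1 -> limit_rate A u s <= limit_rate A u t].
Proof.
rewrite /growth_rate; case: xgetP => [y -> [[t + <-] ub_t] _|]; last by rewrite eqxx.
rewrite /= in_itv /= => t01; exists t; split; [exact: t01|reflexivity|].
by move=> s s01; apply: ub_t; exists s; [rewrite /= in_itv|].
Qed.

Lemma growth_rate_scale (R : realType) (A : 'rV[R]_2) (u c : R) : c != 0 ->
  growth_rate (c *: A) (c * u) = growth_rate A u.
Proof. by move=> c0; rewrite /growth_rate limit_rate_scale. Qed.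

Lemma play_factor_gt0 (R : realType) (A : 'rV[R]_2) (u t : R) (h : bool) :
  positive_game A -> 0 < u -> 0 <= t <= 1 -> 0 < play_factor A u t h.
Proof.
move=> A0 u0 /andP[t0 t1]; rewrite /play_factor.
have [->|tn0] := eqVneq t 0; first by rewrite mulr0 mul0r subr0 add0r.
rewrite ltr_wpDr ?subr_ge0 // divr_gt0 // mulr_gt0 // ?A0 //.
by rewrite lt_def tn0.
Qed.

Lemma limit_rate_ler (R : realType) (A : 'rV[R]_2) (u v t : R) :
  positive_game A -> 0 < u -> u <= v -> 0 <= t <= 1 ->
  limit_rate A v t <= limit_rate A u t.
Proof.
move=> A0 u0 uv t01; have v0 := lt_le_trans u0 uv.
have f0 := fun h => play_factor_gt0 h A0 u0 t01.
have g0 := fun h => play_factor_gt0 h A0 v0 t01.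
rewrite !limit_rateE // ler_sqrt; last by rewrite mulr_ge0 // ltW.
case/andP: t01 => t0 _.
by apply: ler_pM; rewrite ?(ltW (g0 _)) // /play_factor lerD2r ler_wpM2l ?lef_pV2 ?posrE //;
  rewrite mulr_ge0 // ltW ?A0.
Qed.

Lemma limit_rate_ltr (R : realType) (A : 'rV[R]_2) (u v t : R) :
  positive_game A -> 0 < u -> u < v -> 0 < t <= 1 ->
  limit_rate A v t < limit_rate A u t.
Proof.
move=> A0 u0 uv /andP[t0 t1]; have v0 := lt_trans u0 uv.
have t01 : 0 <= t <= 1 by rewrite (ltW t0).
have f0 := fun h => play_factor_gt0 h A0 u0 t01.
have g0 := fun h => play_factor_gt0 h A0 v0 t01.
rewrite !limit_rateE // ltr_sqrt ?mulr_gt0 //.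
by apply: ltr_pM; rewrite ?(ltW (g0 _)) // /play_factor ltrD2r ltr_pM2l ?ltf_pV2 ?posrE //;
  rewrite mulr_gt0 // A0.
Qed.

Lemma limit_rate0 (R : realType) (A : 'rV[R]_2) (u : R) :
  positive_game A -> 0 < u -> limit_rate A u 0 = 1.
Proof.
move=> A0 u0; rewrite limit_rateE => [|h]; last by rewrite play_factor_gt0 ?lexx ?ler01.
by rewrite /play_factor !mulr0 !mul0r subr0 add0r mulr1 sqrtr1.
Qed.

(** Suppose u < v. A fraction t optimal at v is positive, since t = 0 only yields the rate 1. The
    same t yields strictly more at the lower price u, so the two maxima differ. *)
Lemma growth_rate_inj (R : realType) (A : 'rV[R]_2) (u v : R) :
  positive_game A -> 0 < u -> 0 < v -> 1 < growth_rate A u ->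
  growth_rate A u = growth_rate A v -> u = v.
Proof.
move=> A0; wlog uv : u v / u < v => [th|] u0 v0 g1 e.
  have [uv|vu|uv] := ltgtP u v; last exact: uv.
    exact: (th _ _ uv u0 v0 g1 e).
  by apply/esym/(th _ _ vu v0 u0 _ (esym e)); rewrite -e.
have gu : growth_rate A u != 0 by rewrite (gt_eqF (lt_trans ltr01 g1)).
have gv : growth_rate A v != 0 by rewrite -e.
have [t [t01 et _]] := growth_rate_attained gv.
have [s [s01 es max_s]] := growth_rate_attained gu.
have t0 : 0 < t.
  rewrite lt_def; case/andP: (t01) => -> _; rewrite andbT; apply/eqP => t0.
  by move: g1; rewrite e et t0 (limit_rate0 A0 v0) ltxx.
have t01' : 0 < t <= 1 by rewrite t0; case/andP: t01.
have := lt_le_trans (limit_rate_ltr A0 u0 uv t01') (max_s t t01).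
by rewrite -et -es e ltxx.
Qed.

(** * The closed form of the price *)

(* With E the mean, D half the spread of the two profits, q = e^-r and
   k = sqrt (1 - q^2), the price is q sqrt (E^2 - D^2) if D <= k E (the optimal
   fraction is then t = 1) and E - k D otherwise (t is interior).  Truncating D
   at k E puts both cases in a single expression, visibly continuous. *)
Definition price_of (R : rcfType) (q k E D : R) : R :=
  let m := Num.min D (k * E) in q * Num.sqrt (E ^+ 2 - m ^+ 2) - k * (D - m).

(** For profits E + D and E - D, the product of the two play factors is ((t E + (1 - t) u)^2 - (t
    D)^2) / u^2. The last two clauses thus say that its maximum over t is q^-2, that is, that the
    best limit rate is 1/q. *)
Lemma price_of_spec (R : rcfType) (q k E D : R) :
  0 < q < 1 -> 0 <= k -> k ^+ 2 = 1 - q ^+ 2 -> 0 <= D < E ->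
  let u := price_of q k E D in
  [/\ 0 < u <= E * q,
      forall t, 0 <= t <= 1 ->
        q ^+ 2 * ((t * E + (1 - t) * u) ^+ 2 - (t * D) ^+ 2) <= u ^+ 2 &
      exists2 t, 0 <= t <= 1 &
        q ^+ 2 * ((t * E + (1 - t) * u) ^+ 2 - (t * D) ^+ 2) = u ^+ 2].
Proof.
move=> /andP[q0 q1] k0 k2 /andP[D0 DE]; rewrite /price_of.
have E0 : 0 < E := le_lt_trans D0 DE.
have k1 : k < 1 by nra.
have [DkE|kED] := leP D (k * E).
  rewrite subrr mulr0 subr0.
  set s := Num.sqrt _.
  have w0 : 0 < E ^+ 2 - D ^+ 2 by nra.
  have s0 : 0 < s by rewrite sqrtr_gt0.
  have s2 : s ^+ 2 = E ^+ 2 - D ^+ 2 by rewrite sqr_sqrtr // ltW.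
  have sE : s <= E by nra.
  (* After squaring, this is the case condition D <= k E; it is what makes t = 1 optimal. *)
  have qEs : q * E <= s.
    rewrite -(ler_pXn2r (n:=2)) // ?nnegrE; [|nra|exact: ltW].
    rewrite s2 exprMn.
    have : D ^+ 2 <= (k * E) ^+ 2 by nra.
    rewrite exprMn k2; lra.
  split.
  - rewrite mulr_gt0 //= mulrC ler_pM2r //.
  - move=> t /andP[t0 t1].
    (* With D^2 = E^2 - s^2 the left side becomes three terms, to be compared one by one with those
       of s^2 = (t + (1 - t))^2 s^2. *)
    have : (t * E + (1 - t) * (q * s)) ^+ 2 - (t * D) ^+ 2 =
      t ^+ 2 * s ^+ 2 + 2 * t * (1 - t) * (q * E) * s + (1 - t) ^+ 2 * q ^+ 2 * s ^+ 2.
      rewrite [(t * D) ^+ 2]exprMn (_ : D ^+ 2 = E ^+ 2 - s ^+ 2); last by rewrite s2; ring.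
      by ring.
    move=> ->; rewrite exprMn ler_pM2l ?exprn_gt0 //.
    have h1 : 2 * t * (1 - t) * (q * E) * s <= 2 * t * (1 - t) * s ^+ 2.
      rewrite expr2 -!mulrA; do 3! (apply: ler_wpM2l; first lra).
      by rewrite ![_ * (_ * s)]mulrA ler_wpM2r // ltW.
    have h2 : (1 - t) ^+ 2 * q ^+ 2 * s ^+ 2 <= (1 - t) ^+ 2 * s ^+ 2.
      rewrite ler_wpM2r ?sqr_ge0 // ler_piMr ?sqr_ge0 // expr_le1 //; exact: ltW.
    have -> : s ^+ 2 = t ^+ 2 * s ^+ 2 + 2 * t * (1 - t) * s ^+ 2 + (1 - t) ^+ 2 * s ^+ 2.
      by ring.
    lra.
  - exists 1; first by rewrite ler01 lexx.
    by rewrite subrr mul0r addr0 !mul1r -s2 exprMn.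
have -> : q * Num.sqrt (E ^+ 2 - (k * E) ^+ 2) - k * (D - k * E) = E - k * D.
  have -> : E ^+ 2 - (k * E) ^+ 2 = (q * E) ^+ 2 by rewrite !exprMn k2; ring.
  rewrite sqrtr_sqr ger0_norm; last by rewrite mulr_ge0 // ltW.
  transitivity ((q ^+ 2 + k ^+ 2) * E - k * D); first by ring.
  rewrite k2; ring.
set u := E - k * D.
have u0 : 0 < u by rewrite subr_gt0 (le_lt_trans _ DE) // ler_piMl // ltW.
(* Completing the square in t: the bound becomes evident, and equality holds where the square
   vanishes, at t = k u / (q^2 D). *)
have expand t : q ^+ 2 * ((t * E + (1 - t) * u) ^+ 2 - (t * D) ^+ 2) =
    u ^+ 2 - (q ^+ 2 * t * D - k * u) ^+ 2.
  have -> : E = u + k * D by rewrite /u; ring.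
  apply/eqP; rewrite -subr_eq0; apply/eqP.
  transitivity ((k ^+ 2 - (1 - q ^+ 2)) * (u ^+ 2 + q ^+ 2 * t ^+ 2 * D ^+ 2)); first by ring.
  by rewrite k2 subrr mul0r.
have D1 : 0 < D by apply: le_lt_trans kED; rewrite mulr_ge0 // ltW.
split.
- rewrite u0 /= /u.
  have : k * (k * E) <= k * D by rewrite ler_wpM2l // ltW.
  have : E * q ^+ 2 <= E * q by rewrite ler_pM2l // expr2 ler_piMl // ltW.
  rewrite mulrA -expr2 k2; lra.
- by move=> t _; rewrite expand lerBlDr lerDl sqr_ge0.
- exists (k * u / (q ^+ 2 * D)); last first.
    rewrite expand; have -> : q ^+ 2 * (k * u / (q ^+ 2 * D)) * D - k * u = 0.
      by field; rewrite !gt_eqF.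
    by rewrite expr0n subr0.
  have q2D : 0 < q ^+ 2 * D by rewrite mulr_gt0 ?exprn_gt0.
  (* The witness is at most 1 exactly when k u <= q^2 D, which for u = E - k D and k^2 + q^2 = 1
     reduces to k E <= D. *)
  apply/andP; split; first by rewrite divr_ge0 ?mulr_ge0 // ltW.
  rewrite ler_pdivrMr // mul1r /u mulrBr mulrA -expr2 k2; lra.
Qed.

Definition closed_price (R : realType) (r : R) (A : 'rV[R]_2) : R :=
  price_of (expR (- r)) (Num.sqrt (1 - expR (- r) ^+ 2)) (mean_profit A)
    (`|profit A true - profit A false| / 2).

(** With q = e^-r, [price_of_spec] shows that the closed form is a price at which the growth rate is
    e^r. As e^r > 1, [growth_rate_inj] makes it the only one, so [xget] must return it. *)
Lemma price_spec (R : realType) (r : R) (A : 'rV[R]_2) :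
  0 < r -> positive_game A ->
  [/\ price r A = closed_price r A, 0 < price r A <= mean_profit A / expR r &
      growth_rate A (price r A) = expR r].
Proof.
move=> r0 A0; rewrite -expRN.
set q := expR (- r).
have q0 : 0 < q by rewrite expR_gt0.
have q1 : q < 1 by rewrite expR_lt1 oppr_lt0.
have er : expR r = q^-1 by rewrite /q expRN invrK.
set a := profit A true; set b := profit A false.
have a0 : 0 < a := A0 true. have b0 : 0 < b := A0 false.
set D := `|a - b| / 2; set E := mean_profit A.
have D2 : D ^+ 2 = ((a - b) / 2) ^+ 2.
  by rewrite /D !exprMn real_normK ?num_real.
have D0 : 0 <= D < E.
  rewrite divr_ge0 //= /E /mean_profit ltr_pM2r ?invr_gt0 // ltr_norml -/a -/b.
  by apply/andP; split; lra.
set k := Num.sqrt (1 - q ^+ 2).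
have q2 : q ^+ 2 < 1 by rewrite expr_lt1 // ltW.
have k2 : k ^+ 2 = 1 - q ^+ 2 by rewrite sqr_sqrtr // subr_ge0 ltW.
have q01 : 0 < q < 1 by rewrite q0.
have [/andP[u0 uE] u_le [t t01 u_eq]] := price_of_spec q01 (sqrtr_ge0 _) k2 D0.
rewrite -/k in u0 uE u_le u_eq.
have -> : closed_price r A = price_of q k E D by [].
set u := price_of q k E D in u0 uE u_le u_eq *.
(* The profits are E + D and E - D in some order, and the product of the factors is symmetric in
   them. *)
have rate s : 0 <= s <= 1 -> limit_rate A u s =
    Num.sqrt (((s * E + (1 - s) * u) ^+ 2 - (s * D) ^+ 2) / u ^+ 2).
  move=> s01; rewrite limit_rateE; last by move=> h; exact: play_factor_gt0.
  congr Num.sqrt; rewrite exprMn D2 /E /mean_profit /play_factor -/a -/b.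
  by field; rewrite gt_eqF.
have u2 : 0 < u ^+ 2 by rewrite exprn_gt0.
have rate_le s : 0 <= s <= 1 -> limit_rate A u s <= expR r.
  move=> s01; rewrite (rate s s01) er -[leRHS]ger0_norm ?invr_ge0 ?(ltW q0) // -sqrtr_sqr.
  apply: ler_wsqrtr; rewrite ler_pdivrMr // -ler_pdivrMl; last by rewrite exprn_gt0 ?invr_gt0.
  by rewrite exprVn invrK u_le.
have rate_t : limit_rate A u t = expR r.
  rewrite (rate t t01) er -[RHS]ger0_norm ?invr_ge0 ?(ltW q0) // -sqrtr_sqr.
  congr Num.sqrt; rewrite -u_eq; field.
  have : q ^+ 2 * ((t * E + (1 - t) * u) ^+ 2 - (t * D) ^+ 2) != 0.
    by rewrite u_eq gt_eqF.
  by rewrite mulf_eq0 negb_or => /andP[_ ->]; rewrite gt_eqF.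
have gu : growth_rate A u = expR r.
  rewrite -rate_t; apply: growth_rate_eq => // s s01; rewrite rate_t; exact: rate_le.
have pu : price r A = u.
  apply: xget_unique; first by split.
  move=> v [v0 gv]; apply/esym/(growth_rate_inj A0 u0 v0); last by rewrite gv.
  by rewrite gu expR_gt1.
by rewrite pu; split => //; rewrite u0.
Qed.

Lemma price_gt0 (R : realType) (r : R) (A : 'rV[R]_2) :
  0 < r -> positive_game A -> 0 < price r A.
Proof. by move=> r0 A0; have [_ /andP[]] := price_spec r0 A0. Qed.

Lemma growth_rate_le_expR (R : realType) (r v : R) (A : 'rV[R]_2) :
  0 < r -> positive_game A -> price r A <= v -> growth_rate A v <= expR r.
Proof.
move=> r0 A0 uv; have u0 := price_gt0 r0 A0.
have [_ _ gu] := price_spec r0 A0.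
have g0 : growth_rate A (price r A) != 0 by rewrite gu (gt_eqF (expR_gt0 _)).
have [t [_ et max_t]] := growth_rate_attained g0.
apply: growth_rate_le; first exact: expR_ge0.
move=> s s01; rewrite -gu et.
exact: le_trans (limit_rate_ler A0 u0 uv s01) (max_t s s01).
Qed.

(** * Mixed games and the simplex of weights *)

Lemma profit_mix (R : realType) (n : nat) (A : 'I_n -> 'rV[R]_2) (k : 'rV[R]_n) (h : bool) :
  profit (mix A k) h = \sum_i k 0 i * profit (A i) h.
Proof. by rewrite /profit /mix summxE; apply: eq_bigr => i _; rewrite mxE. Qed.

Lemma mean_profit_mix (R : realType) (n : nat) (A : 'I_n -> 'rV[R]_2) (k : 'rV[R]_n) :
  mean_profit (mix A k) = \sum_i k 0 i * mean_profit (A i).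
Proof.
rewrite /mean_profit !profit_mix -big_split mulr_suml; apply: eq_bigr => i _ /=.
by ring.
Qed.

Lemma mix_scale (R : realType) (n : nat) (A : 'I_n -> 'rV[R]_2) (k : 'rV[R]_n) (c : R) :
  mix A (c *: k) = c *: mix A k.
Proof. by rewrite /mix scaler_sumr; apply: eq_bigr => i _; rewrite mxE scalerA. Qed.

Lemma mixed_price_scale (R : realType) (n : nat) (v : 'I_n -> R) (k : 'rV[R]_n) (c : R) :
  mixed_price v (c *: k) = c * mixed_price v k.
Proof. by rewrite /mixed_price mulr_sumr; apply: eq_bigr => i _; rewrite mxE mulrA. Qed.

Lemma mix_delta (R : realType) (n : nat) (A : 'I_n -> 'rV[R]_2) (i : 'I_n) :
  mix A (delta_mx 0 i) = A i.
Proof.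
rewrite /mix (bigD1 i) //= big1 => [|j /negPf ji].
  by rewrite mxE !eqxx scale1r addr0.
by rewrite mxE ji andbF scale0r.
Qed.

Lemma simplex_sum_gt0 (R : realType) (n : nat) (p : 'rV[R]_n) (v : 'I_n -> R) :
  simplex p -> (forall i, 0 < v i) -> 0 < \sum_i p 0 i * v i.
Proof.
move=> [p1 p0] v0; rewrite lt_def sumr_ge0 ?andbT => [|i _]; last first.
  by rewrite mulr_ge0 // ltW.
apply/eqP => s0; move: (oner_neq0 R); rewrite -p1 big1 ?eqxx // => i _.
have := @psumr_eq0P R _ (fun=> true) (fun i => p 0 i * v i).
move=> /(_ (fun i _ => mulr_ge0 (p0 i) (ltW (v0 i))) s0 i isT) /eqP.
by rewrite mulf_eq0 (gt_eqF (v0 i)) orbF => /eqP.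
Qed.

Lemma positive_game_mix (R : realType) (n : nat) (A : 'I_n -> 'rV[R]_2) (p : 'rV[R]_n) :
  (forall i, positive_game (A i)) -> simplex p -> positive_game (mix A p).
Proof.
by move=> A0 Sp h; rewrite profit_mix simplex_sum_gt0 // => i; exact: A0.
Qed.

Lemma positive_game_neq0 (R : realType) (A : 'rV[R]_2) : positive_game A -> A != 0.
Proof.
by move=> A0; apply/eqP => A_0; have := A0 true; rewrite A_0 /profit mxE ltxx.
Qed.

(** Together with [growth_rate_scale], this reduces statements about all nonzero weights to weights
    in the simplex. *)
Lemma nonneg_simplex (R : realType) (n : nat) (k : 'rV[R]_n) :
  nonneg k -> k != 0 ->
  exists2 c, 0 < c & exists2 p, simplex p & k = c *: p.
Proof.
move=> k0 kn0; pose c := \sum_i k 0 i.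
have c0 : 0 < c.
  rewrite lt_def sumr_ge0 ?andbT //; apply: contra kn0 => /eqP /psumr_eq0P s0.
  by apply/eqP/rowP => i; rewrite s0 ?mxE.
exists c => //; exists (c^-1 *: k); last by rewrite scalerA divff ?scale1r ?gt_eqF.
split=> [|i]; last by rewrite mxE mulr_ge0 // invr_ge0 ltW.
rewrite (eq_bigr (fun i => c^-1 * k 0 i)) => [|i _]; last by rewrite mxE.
by rewrite -mulr_sumr mulVf // gt_eqF.
Qed.

(** * The admissible set and its point of least norm *)

Lemma shifted_price_gt0 (R : realType) (r : R) (n : nat) (A : 'I_n -> 'rV[R]_2)
    (t : 'rV[R]_n) (i : 'I_n) :
  0 < r -> positive_game (A i) -> cube t -> 0 < shifted_price r A t i.
Proof.
move=> r0 A0 /(_ i)/andP[t0 _]; have [_ /andP[u0 uE] _] := price_spec r0 A0.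
by rewrite /shifted_price ltr_wpDr // mulr_ge0 // subr_ge0.
Qed.

(** The denominators are positive, so the bound on the supremum unfolds into inequalities, one for
    each p, that are affine in t. This exhibits the set as the cube cut by closed half-spaces. *)
Lemma admissibleP (R : realType) (r : R) (n : nat) (A : 'I_n -> 'rV[R]_2)
    (t : 'rV[R]_n) :
  0 < r -> (forall i, positive_game (A i)) ->
  admissible r A t <->
  cube t /\ forall p, simplex p ->
    price r (mix A p) <= mixed_price (shifted_price r A t) p.
Proof.
move=> r0 A0; split=> -[Ct le_p]; split=> //.
  move=> p Sp.
  have V0 := simplex_sum_gt0 Sp (fun i => shifted_price_gt0 r0 (A0 i) Ct).
  rewrite -[leRHS]mul1r -ler_pdivrMr // -lee_fin.
  by apply: le_trans le_p; apply: ereal_sup_ubound; exists p.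
apply: ge_ereal_sup => _ [p Sp <-].
have V0 := simplex_sum_gt0 Sp (fun i => shifted_price_gt0 r0 (A0 i) Ct).
by rewrite lee_fin ler_pdivrMr // mul1r; exact: le_p.
Qed.

(** At t = 1 the shifted prices are E_i/e^r. The mean is linear, and the price of every positive
    game is at most its mean over e^r. *)
Lemma admissible1 (R : realType) (r : R) (n : nat) (A : 'I_n -> 'rV[R]_2) :
  0 < r -> (forall i, positive_game (A i)) -> admissible r A (const_mx 1).
Proof.
move=> r0 A0; apply/admissibleP => //; split=> [i|p Sp].
  by rewrite mxE ler01 lexx.
have [_ /andP[_ uE] _] := price_spec r0 (positive_game_mix A0 Sp).
apply: le_trans uE _; rewrite mean_profit_mix mulr_suml; apply: ler_sum => i _.
by rewrite /shifted_price mxE mul1r addrC subrK mulrA.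
Qed.

Lemma compact_cube (R : realType) (n : nat) : compact (@cube R n).
Proof.
have -> : @cube R n = [set t : 'rV[R]_n | forall i, `[0, 1]%classic (t 0 i)].
  by apply/seteqP; split=> t Ct i; have := Ct i; rewrite /= in_itv.
by apply: (@rV_compact _ n (fun=> `[0 : R, 1]%classic)) => i; exact: segment_compact.
Qed.

Lemma continuous_coord_sum (R : realType) (n : nat) (f : 'I_n -> R -> R) :
  (forall i, continuous (f i)) ->
  continuous (fun t : 'rV[R]_n => \sum_i f i (t 0 i)).
Proof.
move=> cf; apply: continuous_big => [|i _ t]; first exact: add_continuous.
exact: (@continuous_comp _ _ _ (fun t : 'rV[R]_n => t 0 i) (f i) t (@coord_continuous _ 1 n 0 i t) (cf i _)).
Qed.

Lemma mulr_const_continuous (R : realType) (c : R) : continuous (fun x : R => x * c).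
Proof. by move=> x; apply: cvgM; [exact: cvg_id|exact: cvg_cst]. Qed.

Lemma simplex_cube (R : realType) (n : nat) : @simplex R n `<=` @cube R n.
Proof.
move=> p [p1 p0] i; rewrite p0 /= -p1 (bigD1 i) //= lerDl.
by apply: sumr_ge0.
Qed.

Lemma compact_simplex (R : realType) (n : nat) : compact (@simplex R n).
Proof.
pose s (p : 'rV[R]_n) := \sum_i p 0 i.
have -> : @simplex R n = @cube R n `&` s @^-1` [set x | x = 1].
  apply/seteqP; split=> [p Sp|p [Cp p1]]; last first.
    by split=> // i; have /andP[] := Cp i.
  by split; [exact: simplex_cube|case: Sp].
apply: compact_closedI; first exact: compact_cube.
apply: preimage_closed; last exact: closed_eq.
by move=> p _; apply: (@continuous_coord_sum R n (fun _ x => x)) => i x; exact: cvg_id.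
Qed.

Lemma compact_admissible (R : realType) (r : R) (n : nat) (A : 'I_n -> 'rV[R]_2) :
  0 < r -> (forall i, positive_game (A i)) -> compact (admissible r A).
Proof.
move=> r0 A0.
pose V p (t : 'rV[R]_n) := mixed_price (shifted_price r A t) p.
have -> : admissible r A = @cube R n `&`
    \bigcap_(p in @simplex R n) (V p @^-1` [set x | price r (mix A p) <= x]).
  apply/seteqP; split=> t; first by move/admissibleP => [].
  by move=> [Ct le_p]; apply/admissibleP.
apply: compact_closedI; first exact: compact_cube.
apply: closed_bigI => p _; apply: preimage_closed; last exact: closed_ge.
move=> t _; apply: (@continuous_coord_sum R n (fun i x =>
  p 0 i * (price r (A i) + x * (mean_profit (A i) / expR r - price r (A i))))).
move=> i x; apply: cvgM; first exact: cvg_cst.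
by apply: cvgD; [exact: cvg_cst|exact: mulr_const_continuous].
Qed.

(** The sum of squares is continuous and attains its minimum on the nonempty compact admissible set,
    so [xget] does not return its default. *)
Lemma least_squares_pointP (R : realType) (r : R) (n : nat) (A : 'I_n -> 'rV[R]_2) :
  0 < r -> (forall i, positive_game (A i)) ->
  let x := least_squares_point r A in
  admissible r A x /\
  forall t, admissible r A t -> \sum_i x 0 i ^+ 2 <= \sum_i t 0 i ^+ 2.
Proof.
move=> r0 A0; rewrite /least_squares_point.
case: xgetP => [x -> //|no_min]; exfalso.
have T0 : admissible r A !=set0 by exists (const_mx 1); exact: admissible1.
have [|c + le_c] := EVT_min_rV (f := fun t => \sum_i t 0 i ^+ 2) T0
    (compact_admissible r0 A0).
  apply: continuous_subspaceT; apply: (@continuous_coord_sum R n (fun _ y => y ^+ 2)).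
  by move=> i; exact: exprn_continuous.
rewrite inE => Tc; apply: (no_min c); split=> // t Tt; by apply: le_c; rewrite inE.
Qed.

(** * Continuity of the price and the extremal argument *)

Lemma continuous_price_of (R : realType) (T : topologicalType) (q k : R) (E D : T -> R) :
  continuous E -> continuous D ->
  continuous (fun x => price_of q k (E x) (D x)).
Proof.
move=> cE cD x; rewrite /price_of.
have cm : {for x, continuous (fun x => Num.min (D x) (k * E x))}.
  apply: (@continuous_min R T D (fun x => k * E x)); first exact: cD.
  exact: (cvgM (cvg_cst _) (cE x)).
apply: cvgB; apply: cvgM; try exact: cvg_cst.
  apply: (@cvg_comp _ _ _ _ Num.sqrt); last exact: sqrt_continuous.
  by apply: cvgB; apply: cvgM => //; exact: cE.
by apply: cvgB; [exact: cD|exact: cm].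
Qed.

Lemma continuous_closed_price_mix (R : realType) (r : R) (n : nat)
    (A : 'I_n -> 'rV[R]_2) :
  continuous (fun p : 'rV[R]_n => closed_price r (mix A p)).
Proof.
have cP h : continuous (fun p : 'rV[R]_n => profit (mix A p) h).
  under eq_fun do rewrite profit_mix.
  by apply: (@continuous_coord_sum R n (fun i x => x * profit (A i) h)) => i; exact: mulr_const_continuous.
apply: continuous_price_of => p.
  exact: (cvgM (cvgD (cP true p) (cP false p)) (cvg_cst _)).
exact: (cvgM (cvg_norm (cvgB (cP true p) (cP false p))) (cvg_cst _)).
Qed.

Lemma least_squares_prices_arbitrage_free (R : realType) (r : R) (n : nat) (A : 'I_n -> 'rV[R]_2) :
  0 < r -> (0 < n)%N -> (forall i, positive_game (A i)) ->
  arbitrage_free r A (least_squares_price r A) /\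
  exists k : 'rV[R]_n,
    [/\ nonneg k, mix A k != 0 &
        growth_rate (mix A k) (mixed_price (least_squares_price r A) k)
          = expR r].
Proof.
move=> r0 n0 A0; have [Tx x_min] := least_squares_pointP r0 A0.
rewrite /least_squares_price.
set x := least_squares_point r A in Tx x_min *.
set v := shifted_price r A x.
have /(admissibleP _ r0 A0)[Cx le_V] := Tx.
have v0 i : 0 < v i by exact: shifted_price_gt0.
split.
  move=> k k0 Mn0.
  have kn0 : k != 0.
    apply: contra Mn0 => /eqP ->; rewrite /mix big1 // => i _.
    by rewrite mxE scale0r.
  (* Scaling game and price together leaves the growth rate unchanged, so only weights in the
     simplex matter. *)
  have [c c0 [p Sp ->]] := nonneg_simplex k0 kn0.
  rewrite mix_scale mixed_price_scale growth_rate_scale ?gt_eqF //.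
  apply: growth_rate_le_expR => //; first exact: positive_game_mix.
  exact: le_V.
(* The ratio is written with [closed_price], whose continuity is known; on the simplex it agrees
   with [price], by [phi_price] below. *)
pose phi (p : 'rV[R]_n) := closed_price r (mix A p) / mixed_price v p.
have [||p Sp phi_max] := EVT_max_rV (f := phi) _ (@compact_simplex R n).
- exists (delta_mx 0 (Ordinal n0)); split=> [|i]; last by rewrite mxE ler0n.
  rewrite (bigD1 (Ordinal n0)) //= mxE !eqxx big1 ?addr0 // => i /negPf i0.
  by rewrite mxE i0.
- apply: continuous_in_subspaceT => p; rewrite inE => Sp.
  have V_neq0 : mixed_price v p != 0 by rewrite gt_eqF // simplex_sum_gt0.
  have cV := @continuous_coord_sum R n (fun i y => y * v i)
    (fun i => @mulr_const_continuous R (v i)) p.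
  exact: (cvgM (@continuous_closed_price_mix R r n A p) (cvgV V_neq0 cV)).
move: Sp; rewrite inE => Sp.
have Mp := positive_game_mix A0 Sp.
have V0 q : simplex q -> 0 < mixed_price v q.
  by move=> Sq; exact: simplex_sum_gt0.
have phi_price q : simplex q -> phi q = price r (mix A q) / mixed_price v q.
  by move=> Sq; rewrite /phi; have [->] := price_spec r0 (positive_game_mix A0 Sq).
have phi_gt0 : 0 < phi p by rewrite phi_price // divr_gt0 ?V0 ?price_gt0.
have phi_le1 : phi p <= 1 by rewrite phi_price // ler_pdivrMr ?V0 // mul1r le_V.
have [phi1|phi_ne1] := eqVneq (phi p) 1.
  exists p; split; [by case: Sp|exact: positive_game_neq0|].
  have <- : price r (mix A p) = mixed_price v p.
    by move: phi1; rewrite phi_price // => /divr1_eq.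
  by have [] := price_spec r0 Mp.
have phi_lt1 : phi p < 1 by rewrite lt_def eq_sym phi_ne1.
have Tpx : admissible r A (phi p *: x).
  apply/admissibleP => //; split=> [i|q Sq].
    have /andP[x0 x1] := Cx i; rewrite mxE mulr_ge0 ?(ltW phi_gt0) //=.
    by rewrite mulr_ile1 // ltW.
  have : phi q <= phi p by apply: phi_max; rewrite inE.
  rewrite phi_price // ler_pdivrMr ?V0 // => /le_trans; apply.
  (* The comparison is termwise: scaling x by [phi p] scales only the shift, whereas the left side
     also scales the positive price of each game. *)
  rewrite /mixed_price mulr_sumr; apply: ler_sum => i _.
  have [_ q0] := Sq.
  rewrite mulrCA ler_wpM2l // /v /shifted_price mxE mulrDr mulrA lerD2r.
  by rewrite ler_piMl // ltW // price_gt0.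
have x2_0 : \sum_i x 0 i ^+ 2 = 0.
  apply/le_anti/andP; split; last by apply: sumr_ge0 => i _; exact: sqr_ge0.
  (* The squared norm of the scaled point is [phi p] squared times that of x, so minimality gives (1
     - [phi p]^2) |x|^2 <= 0 with a positive first factor. *)
  have := x_min _ Tpx.
  under [X in _ <= X -> _]eq_bigr do rewrite mxE exprMn.
  rewrite -mulr_sumr -subr_le0 -[X in X - _]mul1r -mulrBl pmulr_rle0 //.
  by rewrite subr_gt0 expr_lt1 // ltW.
pose i0 := Ordinal n0.
have xi0 : x 0 i0 = 0.
  have /eqP : x 0 i0 ^+ 2 = 0.
    by apply: (psumr_eq0P _ x2_0) => // i _; exact: sqr_ge0.
  by rewrite sqrf_eq0 => /eqP.
exists (delta_mx 0 i0); rewrite mix_delta; split.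
- by move=> i; rewrite mxE ler0n.
- exact: positive_game_neq0.
- have -> : mixed_price v (delta_mx 0 i0) = price r (A i0).
    rewrite /mixed_price (bigD1 i0) //= mxE !eqxx mul1r big1 => [|i /negPf ii0].
      by rewrite /v /shifted_price xi0 mul0r !addr0.
    by rewrite mxE ii0 mul0r.
  by have [] := price_spec r0 (A0 i0).
Qed.

Theorem theorem2p4 (R : realType) (r : R) (hr : 0 < r)
    (n : nat) (hn : n = 1%N \/ n = 2%N)
    (A : 'I_n -> 'rV[R]_2) (hA : forall i, positive_game (A i))
    (hbasis : cone_basis A) :
  arbitrage_free r A (least_squares_price r A) /\
  exists k : 'rV[R]_n,
    [/\ nonneg k, mix A k != 0 &
        growth_rate (mix A k) (mixed_price (least_squares_price r A) k)
          = expR r].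
Proof. by apply: least_squares_prices_arbitrage_free => //; case: hn => ->. Qed.
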